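(* For every integer $i\ge1$, writing $\Pi(i)=\prod_{j=1}^{i}j!$, we have $\Pi(i)\,\psi_i(n)\in\mathbb{Z}[a_1,\dots,a_6][n]$, where $\psi_i(n)$ is regarded as the polynomial in $\mathbb{Q}[a_1,\dots,a_6][n]$ that agrees with the $i$-th multiplication polynomial for all $n\in\mathbb N$.
   Context: Let $a_1,\dots,a_6$ be indeterminates and consider the generic Weierstrass curve $y^2z+a_1xyz+a_3yz^2=x^3+a_2x^2z+a_4xz^2+a_6z^3$ with its usual group law (identity $(0:1:0)$). For an integer $K\ge 2$ let $A_K=\mathbb{Z}[a_1,\dots,a_6][X]/(X^K)$ and let $F(X)\in X^3A_K$ be the unique element with $F=X^3-a_1XF+a_2X^2F-a_3F^2+a_4XF^2+a_6F^3$, so $P=(X:1:F(X))$ lies on the curve over $A_K$. For $n\in\mathbb N$, normalizing the $y$-coordinate of $nP$ to $1$, its $x$-coordinate is $\sum_{i=1}^{K-1}\psi_i(n)X^i$ with unique $\psi_i(n)\in\mathbb{Z}[a_1,\dots,a_6]$ (independent of $K\ge i+1$); $\psi_i$ is the $i$-th multiplication polynomial. It is known that $n\mapsto\psi_i(n)$ agrees with a polynomial in $\mathbb{Q}[a_1,\dots,a_6][n]$ of degree $i$ in $n$. *)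

(* Defs.v *)
From HB Require Import structures.
From mathcomp Require Import all_boot all_order all_algebra.
From mathcomp Require Import qpoly ring.
From mathcomp Require Import mpoly.

Set Implicit Arguments.
Unset Strict Implicit.
Unset Printing Implicit Defensive.

Import GRing.Theory.
Local Open Scope ring_scope.

Record weierstrass (A : Type) :=
  Weierstrass { wa1 : A; wa2 : A; wa3 : A; wa4 : A; wa6 : A }.

(* The curve is the zero locus of [weq E]. *)
Definition weq (A : comNzRingType) (E : weierstrass A) (x y z : A) : A :=
  x ^+ 3 + wa2 E * x ^+ 2 * z + wa4 E * x * z ^+ 2 + wa6 E * z ^+ 3
  - (y ^+ 2 * z + wa1 E * x * y * z + wa3 E * y * z ^+ 2).

(* Inverse of [u] when [(1 - u) ^+ K = 0], see [ninvP].  It is given by a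
   formula because {poly %/ 'X^K} has no inversion in the library unless the
   coefficients form a field. *)
Definition ninv (A : comNzRingType) (K : nat) (u : A) : A :=
  \sum_(k < K) (1 - u) ^+ k.

(* Chord-and-tangent group law in the affine chart y = 1.  A pair (x, z) stands
   for the projective point (x : 1 : z), so that (0, 0) is the identity
   (0 : 1 : 0).  It is only used at points whose coordinates are nilpotent of
   order at most K; all the elements to be inverted are then of the form
   1 - (nilpotent).  For such points the chart y = 1 is closed under the
   group law. *)

(* The line z = lambda * x + nu through P and Q (the tangent when P = Q) has
   slope slope_num / slope_den: subtracting the equations of P and Q gives
   (x1 - x2) * slope_num = (z1 - z2) * slope_den, see [slope_eq]. *)
Definition slope_num (A : comNzRingType) (E : weierstrass A) (P Q : A * A) : A :=
  let: (x1, z1) := P in let: (x2, z2) := Q in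
  x1 ^+ 2 + x1 * x2 + x2 ^+ 2 + wa2 E * (x1 + x2) * z1
  + wa4 E * z1 ^+ 2 - wa1 E * z1.

Definition slope_den (A : comNzRingType) (E : weierstrass A) (P Q : A * A) : A :=
  let: (x1, z1) := P in let: (x2, z2) := Q in
  1 + wa1 E * x2 + wa3 E * (z1 + z2) - wa2 E * x2 ^+ 2
  - wa4 E * x2 * (z1 + z2) - wa6 E * (z1 ^+ 2 + z1 * z2 + z2 ^+ 2).

Definition slope (A : comNzRingType) (E : weierstrass A) (K : nat)
    (P Q : A * A) : A :=
  slope_num E P Q * ninv K (slope_den E P Q).

(* Coefficients of t ^+ 3 and t ^+ 2 in weq E t 1 (l * t + nu). *)
Definition lead3 (A : comNzRingType) (E : weierstrass A) (l : A) : A :=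
  1 + wa2 E * l + wa4 E * l ^+ 2 + wa6 E * l ^+ 3.

Definition lead2 (A : comNzRingType) (E : weierstrass A) (l nu : A) : A :=
  wa2 E * nu + wa4 E * l * nu *+ 2 + wa6 E * l ^+ 2 * nu *+ 3
  - wa1 E * l - wa3 E * l ^+ 2.

(* Third intersection point of the curve with the line through P and Q, counted
   with multiplicities, see [third_pointP]. *)
Definition third_point (A : comNzRingType) (E : weierstrass A) (K : nat)
    (P Q : A * A) : A * A :=
  let l := slope E K P Q in
  let nu := P.2 - l * P.1 in
  let x3 := - lead2 E l nu * ninv K (lead3 E l) - P.1 - Q.1 in
  (x3, l * x3 + nu).

(* - (x : y : z) = (x : - y - a1 x - a3 z : z), see [reflectP]; for y = 1 the
   three coordinates are divided by the second one. *)
Definition point_opp (A : comNzRingType) (E : weierstrass A) (K : nat)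
    (P : A * A) : A * A :=
  let e := ninv K (1 + wa1 E * P.1 + wa3 E * P.2) in (- P.1 * e, - P.2 * e).

Definition point_add (A : comNzRingType) (E : weierstrass A) (K : nat)
    (P Q : A * A) : A * A :=
  point_opp E K (third_point E K P Q).

Definition point_mul (A : comNzRingType) (E : weierstrass A) (K : nat)
    (n : nat) (P : A * A) : A * A :=
  iter n (point_add E K P) (0, 0).

(* Z[a1, a2, a3, a4, a6]: the five variables are those with index 0, ..., 4. *)
Notation Za := {mpoly int[5]}.
Notation Qa := {mpoly rat[5]}.

Notation trunc_ring K := {poly %/ ('X^K : {poly Za})}.

Definition indet (k : nat) : Za := 'X_(inord k : 'I_5).

Definition generic_curve (K : nat) : weierstrass (trunc_ring K) :=
  let c k := qpolyC 'X^K (indet k) in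
  Weierstrass (c 0%N) (c 1%N) (c 2%N) (c 3%N) (c 4%N).

Definition trX (K : nat) : trunc_ring K := in_qpoly 'X^K 'X.

(* F is the element F(X) of X^3 A_K; existence and uniqueness are
   [paramF_exists] and [paramF_uniq]. *)
Definition paramF (A : comNzRingType) (E : weierstrass A) (x F : A) : Prop :=
  (exists g, F = x ^+ 3 * g) /\
  F = x ^+ 3 - wa1 E * x * F + wa2 E * x ^+ 2 * F - wa3 E * F ^+ 2
      + wa4 E * x * F ^+ 2 + wa6 E * F ^+ 3.

(* The i-th multiplication polynomial at n, computed modulo X^K with F(X) = F. *)
Definition mult_poly (K : nat) (F : trunc_ring K) (i n : nat) : Za :=
  (point_mul (generic_curve K) K n (trX K, F)).1`_i.

Definition superfact (i : nat) : nat := (\prod_(1 <= j < i.+1) j`!)%N.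

Definition ZtoQ : Za -> Qa := map_mpoly (intr : int -> rat).

Lemma ninvP (A : comNzRingType) (K : nat) (u : A) :
  (1 - u) ^+ K = 0 -> u * ninv K u = 1.
Proof.
move=> h; have := subrX1 (1 - u) K; rewrite h sub0r -/(ninv K u).
have -> : 1 - u - 1 = - u by ring.
by rewrite mulNr => /oppr_inj.
Qed.

Lemma slope_eq (A : comNzRingType) (E : weierstrass A) (x1 z1 x2 z2 : A) :
  weq E x1 1 z1 - weq E x2 1 z2 =
  (x1 - x2) * slope_num E (x1, z1) (x2, z2)
  - (z1 - z2) * slope_den E (x1, z1) (x2, z2).
Proof. by rewrite /weq /=; ring. Qed.

Lemma third_pointP (A : comNzRingType) (E : weierstrass A) (K : nat)
    (P Q : A * A) :
  let l := slope E K P Q in let nu := P.2 - l * P.1 in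
  let S := third_point E K P Q in
  weq E P.1 1 P.2 = 0 -> weq E Q.1 1 Q.2 = 0 ->
  (1 - slope_den E P Q) ^+ K = 0 -> (1 - lead3 E l) ^+ K = 0 ->
  [/\ P.2 = l * P.1 + nu, Q.2 = l * Q.1 + nu, S.2 = l * S.1 + nu &
  forall t, weq E t 1 (l * t + nu)
            = lead3 E l * (t - P.1) * (t - Q.1) * (t - S.1)].
Proof.
case: P Q => [x1 z1] [x2 z2] l nu S; rewrite [(x1, z1).1]/= [(x1, z1).2]/=.
rewrite [(x2, z2).1]/= [(x2, z2).2]/= => hP hQ hD hc.
have nuE : nu = z1 - l * x1 by [].
have S2 : S.2 = l * S.1 + nu by [].
have hl : slope_den E (x1, z1) (x2, z2) * l = slope_num E (x1, z1) (x2, z2).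
  by rewrite /l /slope mulrCA ninvP // mulr1.
have hs : lead3 E l * (x1 + x2 + S.1) = - lead2 E l nu.
  have -> : x1 + x2 + S.1 = - lead2 E l nu * ninv K (lead3 E l).
    by rewrite /S /third_point /= -/l -/nu; ring.
  by rewrite mulrCA ninvP // mulr1.
have hz : z2 = l * x2 + nu.
  have := slope_eq E x1 z1 x2 z2; rewrite hP hQ subr0 -hl => h.
  have : slope_den E (x1, z1) (x2, z2) * (z2 - (l * x2 + nu)) = 0.
    by rewrite h nuE; ring.
  move/(congr1 ( *%R (ninv K (slope_den E (x1, z1) (x2, z2))))).
  rewrite mulr0 mulrA [X in X * _]mulrC ninvP // mul1r => /eqP.
  by rewrite subr_eq0 => /eqP.
have hz1 : z1 = l * x1 + nu by rewrite nuE; ring.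
split=> // t.
clearbody S nu l; clear nuE S2 hD hc.
move: hl hP hQ; rewrite hz1 hz => hl hP hQ.
suff : weq E t 1 (l * t + nu)
    - lead3 E l * (t - x1) * (t - x2) * (t - S.1) = 0.
  by move/eqP; rewrite subr_eq0 => /eqP.
rewrite -[RHS]addr0 -{1}hP.
have <- : (t - x1) * (slope_num E (x1, l * x1 + nu) (x2, l * x2 + nu)
   - slope_den E (x1, l * x1 + nu) (x2, l * x2 + nu) * l)
   + (t - x1) * (t - x2) * (lead3 E l * (x1 + x2 + S.1) + lead2 E l nu) = 0.
  by rewrite hs -hl subrr addNr !mulr0 addr0.
by rewrite /weq /lead3 /lead2 /=; ring.
Qed.

(* The line through (x : y : z) and (0 : 1 : 0). *)
Lemma reflectP (A : comNzRingType) (E : weierstrass A) (x y z t : A) :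
  weq E x y z = 0 ->
  weq E x t z = - z * (t - y) * (t - (- y - wa1 E * x - wa3 E * z)).
Proof.
move=> h; rewrite -[LHS]subr0 -{1}h /weq; ring.
Qed.

Lemma paramF_uniq (A : comNzRingType) (E : weierstrass A) (K : nat) (x F G : A) :
  x ^+ K = 0 -> paramF E x F -> paramF E x G -> F = G.
Proof.
move=> hx [[f Ff] hF] [[g Gg] hG].
have [h hh] : exists h, F - G = (F - G) * (x * h).
  exists (- wa1 E + wa2 E * x - wa3 E * x ^+ 2 * (f + g)
      + wa4 E * x ^+ 3 * (f + g)
      + wa6 E * x ^+ 5 * (f ^+ 2 + f * g + g ^+ 2)).
  rewrite {1}hF {1}hG Ff Gg; ring.
have hn n : F - G = (F - G) * (x * h) ^+ n.
  by elim: n => [|n IHn]; rewrite ?mulr1 // exprS mulrA -hh.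
by apply/eqP; rewrite -subr_eq0 (hn K) exprMn hx mul0r mulr0.
Qed.

Lemma paramF_exists (A : comNzRingType) (E : weierstrass A) (K : nat) (x : A) :
  x ^+ K = 0 -> exists F, paramF E x F.
Proof.
move=> hx; pose step F : A := x ^+ 3 - wa1 E * x * F + wa2 E * x ^+ 2 * F
  - wa3 E * F ^+ 2 + wa4 E * x * F ^+ 2 + wa6 E * F ^+ 3.
have h3 n : exists g, iter n step 0 = x ^+ 3 * g.
  elim: n => [|n [g hg]]; first by exists 0; rewrite mulr0.
  exists (1 - wa1 E * x * g + wa2 E * x ^+ 2 * g - wa3 E * x ^+ 3 * g ^+ 2
    + wa4 E * x ^+ 4 * g ^+ 2 + wa6 E * x ^+ 6 * g ^+ 3).
  by rewrite iterS hg /step; ring.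
have hd n : exists h, iter n.+1 step 0 - iter n step 0 = x ^+ n * h.
  elim: n => [|n [h hh]]; first by eexists; rewrite mul1r.
  have [f hf] := h3 n.+1; have [g hg] := h3 n.
  exists (h * (- wa1 E + wa2 E * x - wa3 E * x ^+ 2 * (f + g)
      + wa4 E * x ^+ 3 * (f + g)
      + wa6 E * x ^+ 5 * (f ^+ 2 + f * g + g ^+ 2))).
  rewrite [x ^+ n.+1]exprSr -mulrA [x * (h * _)]mulrCA [x ^+ n * _]mulrA -hh.
  change (iter n.+2 step 0) with (step (iter n.+1 step 0)).
  rewrite {2}[iter n.+1 step 0]iterS hf hg /step; ring.
exists (iter K step 0); split; first exact: h3.
have [h] := hd K; rewrite hx mul0r => /eqP; rewrite subr_eq0 => /eqP.
by rewrite iterS => {1}<-.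
Qed.

(* On points of the curve with coordinates in x A, where x ^+ K = 0, every
   element inverted by the group law is invertible, and the sum is again such a
   point. *)
Lemma small_nilp (A : comNzRingType) (K : nat) (x u : A) :
  x ^+ K = 0 -> (exists g, 1 - u = x * g) -> (1 - u) ^+ K = 0.
Proof. by move=> hx [g ->]; rewrite exprMn hx mul0r. Qed.

Definition small_point (A : comNzRingType) (E : weierstrass A) (x : A)
    (P : A * A) : Prop :=
  [/\ weq E P.1 1 P.2 = 0, exists g, P.1 = x * g & exists g, P.2 = x * g].

Lemma third_point_small (A : comNzRingType) (E : weierstrass A) (K : nat)
    (x : A) (P Q : A * A) :
  x ^+ K = 0 -> small_point E x P -> small_point E x Q ->
  [/\ (1 - slope_den E P Q) ^+ K = 0, (1 - lead3 E (slope E K P Q)) ^+ K = 0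
    & small_point E x (third_point E K P Q)].
Proof.
move=> hx [hP [p hp] [q hq]] [hQ [r hr] [s hs]].
have hD : (1 - slope_den E P Q) ^+ K = 0.
  apply: (small_nilp hx).
  case: P Q {hP hQ} hp hq hr hs => [? ?] [? ?] /= e1 e2 e3 e4.
  rewrite ?e1 ?e2 ?e3 ?e4.
  exists (- wa1 E * r - wa3 E * (q + s) + wa2 E * x * r ^+ 2
    + wa4 E * x * r * (q + s) + wa6 E * x * (q ^+ 2 + q * s + s ^+ 2)).
  ring.
have [l hl] : exists l, slope E K P Q = x * l.
  rewrite /slope; move: (ninv K _) => d.
  case: P Q {hP hQ hD} hp hq hr hs => [? ?] [? ?] /= e1 e2 e3 e4.
  rewrite ?e1 ?e2 ?e3 ?e4.
  exists ((x * (p ^+ 2 + p * r + r ^+ 2) + wa2 E * x * (p + r) * q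
    + wa4 E * x * q ^+ 2 - wa1 E * q) * d).
  ring.
have hc : (1 - lead3 E (slope E K P Q)) ^+ K = 0.
  apply: (small_nilp hx); rewrite hl /lead3.
  exists (- (wa2 E * l + wa4 E * x * l ^+ 2 + wa6 E * x ^+ 2 * l ^+ 3)).
  ring.
split=> //.
have [_ _ h2 h] := third_pointP hP hQ hD hc.
have h1 : exists g, (third_point E K P Q).1 = x * g.
  rewrite /third_point /= hl hp hq hr /lead2; move: (ninv K _) => d.
  pose nu := q - l * x * p.
  exists (- (wa2 E * nu + wa4 E * x * l * nu *+ 2
     + wa6 E * x ^+ 2 * l ^+ 2 * nu *+ 3 - wa1 E * l - wa3 E * x * l ^+ 2) * d
     - p - r).
  rewrite /nu; ring.
split=> //; first by rewrite h2 h subrr mulr0.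
have [g hg] := h1; rewrite h2 hg hl hp hq.
exists (l * x * g + (q - l * x * p)); ring.
Qed.

Lemma point_opp_small (A : comNzRingType) (E : weierstrass A) (K : nat)
    (x : A) (P : A * A) :
  x ^+ K = 0 -> small_point E x P ->
  (1 + wa1 E * P.1 + wa3 E * P.2) * ninv K (1 + wa1 E * P.1 + wa3 E * P.2) = 1
  /\ small_point E x (point_opp E K P).
Proof.
move=> hx [hP [p hp] [q hq]].
set u := 1 + _ + _.
have hu : u * ninv K u = 1.
  apply/ninvP/(small_nilp hx); rewrite /u hp hq.
  exists (- wa1 E * p - wa3 E * q); ring.
split=> //; rewrite /point_opp -/u; move: (ninv K u) hu => e hu; split => /=.
- have -> : weq E (- P.1 * e) 1 (- P.2 * e) = weq E (- P.1 * e) (u * e) (- P.2 * e).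
    by rewrite hu.
  transitivity (- e ^+ 3 * weq E P.1 1 P.2); last by rewrite hP mulr0.
  rewrite /u /weq; ring.
- by exists (- p * e); rewrite hp; ring.
- by exists (- q * e); rewrite hq; ring.
Qed.

Lemma point_mul_small (A : comNzRingType) (E : weierstrass A) (K : nat)
    (x F : A) (n : nat) :
  x ^+ K = 0 -> paramF E x F -> small_point E x (point_mul E K n (x, F)).
Proof.
move=> hx [[f Ff] hF].
have hP : small_point E x (x, F).
  split=> /=; last by exists (x ^+ 2 * f); rewrite Ff; ring.
    have := subrr F; rewrite {1}hF => h; rewrite -[RHS]h /weq; ring.
  by exists 1; rewrite mulr1.
elim: n => [|n IHn].
  by split=> /=; [rewrite /weq; ring | exists 0; rewrite mulr0 ..].
have [_ _ h] := third_point_small hx hP IHn.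
by have [] := point_opp_small hx h.
Qed.

Lemma trX_nilp (K : nat) : (0 < K)%N -> trX K ^+ K = 0.
Proof.
move=> K0; rewrite /trX -rmorphXn /=; apply/val_inj => /=.
by rewrite mk_monic_Xn; case: K K0 => // K _; rewrite Pdiv.RingMonic.rmodpp // monicXn.
Qed.

(* Main.v *)
(* Call a sequence n |-> g(n) of truncated power series integral below degree m
   if, for i < m, the i-th coefficient times superfact i is a polynomial in n
   of degree at most i with coefficients in the base ring.  These sequences form
   a ring, because superfact i * superfact j divides superfact (i + j).  The
   addition P + Q is polynomial in the coordinates of P and Q, P = (X : 1 : F)
   reduces to the identity modulo X, and O + Q = Q, so the coordinates of
   (n + 1)P and nP differ by X times a polynomial in the coordinates of nP.
   Summing over n raises the degree by one and, for summands of degree less than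
   i, costs a denominator i!, so integrality below degree m implies integrality
   below degree m + 1. *)
Require Import Defs.
From HB Require Import structures.
From mathcomp Require Import all_boot all_order all_algebra.
From mathcomp Require Import qpoly mpoly.
From mathcomp Require Import ring.
Set Implicit Arguments.
Unset Strict Implicit.
Unset Printing Implicit Defensive.
Import GRing.Theory.
Local Open Scope ring_scope.

(** * Divisibility of superfactorials *)

Lemma superfactS i : superfact i.+1 = (superfact i * i.+1`!)%N.
Proof. by rewrite /superfact big_nat_recr. Qed.

Lemma superfact_gt0 i : (0 < superfact i)%N.
Proof.
elim: i => [|i IHi]; first by rewrite /superfact big_geq.
by rewrite superfactS muln_gt0 IHi fact_gt0.
Qed.

(** Raising $j$ by one multiplies the left side by $(j+1)!$ and the right side by $(i+j+1)!$, a
    multiple of it by the binomial formula. *)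
Lemma dvdn_superfactD i j : (superfact i * superfact j %| superfact (i + j))%N.
Proof.
elim: j => [|j IHj]; first by rewrite addn0 [superfact 0]big_geq // muln1.
rewrite addnS !superfactS mulnA dvdn_mul // -addnS.
by rewrite -(bin_fact (leq_addl i j.+1)) mulnCA dvdn_mulr.
Qed.

(** * Falling factorials and summation of polynomial sequences *)

Section FallingFactorial.
Variable R : comNzRingType.

Definition ffact_poly d : {poly R} := \prod_(k < d) ('X - k%:R%:P).

Lemma ffact_polyS d : ffact_poly d.+1 = ffact_poly d * ('X - d%:R%:P).
Proof. by rewrite /ffact_poly big_ord_recr. Qed.

Lemma monic_ffact_poly d : ffact_poly d \is monic.
Proof. by apply: monic_prod => k _; apply: monicXsubC. Qed.

Lemma size_ffact_poly d : size (ffact_poly d) = d.+1.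
Proof.
elim: d => [|d IHd]; first by rewrite /ffact_poly big_ord0 size_poly1.
rewrite ffact_polyS size_Mmonic ?monicXsubC ?monic_neq0 ?monic_ffact_poly //.
by rewrite IHd size_XsubC addn2.
Qed.

Lemma ffact_poly_rec d (x : R) :
  (ffact_poly d.+1).[x + 1] = (ffact_poly d.+1).[x] + d.+1%:R * (ffact_poly d).[x].
Proof.
have shift e : (ffact_poly e.+1).[x + 1] = (x + 1) * (ffact_poly e).[x].
  elim: e => [|e IHe]; first by rewrite ffact_polyS /ffact_poly big_ord0 !hornerE; ring.
  rewrite ffact_polyS hornerM IHe [in RHS]ffact_polyS hornerM !hornerXsubC -natr1; ring.
rewrite shift ffact_polyS hornerM hornerXsubC -natr1; ring.
Qed.

(** Falling factorials are monic, so over any ring the top term of [q] splits off as a multiple of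
    one. Summing the falling factorial of degree $k$ costs only the denominator $k+1$, and these
    accumulate to $d!$. *)
Lemma fact_sum_poly d (q : {poly R}) : (size q <= d)%N ->
  exists2 s : {poly R}, (size s <= d.+1)%N &
    forall n, s.[n%:R] = d`!%:R * \sum_(m < n) q.[m%:R].
Proof.
elim: d q => [|d IHd] q.
  rewrite leqn0 size_poly_eq0 => /eqP ->; exists 0; rewrite ?size_poly0 // => n.
  by rewrite horner0 big1 ?mulr0 // => m _; rewrite horner0.
move=> sq; pose r := q - q`_d *: ffact_poly d.
have [|s ss sE] := IHd r.
  apply/leq_sizeP => j; rewrite leq_eqVlt => /predU1P[<-|dj].
    rewrite coefB coefZ; have /monicP := monic_ffact_poly d.
    by rewrite lead_coefE size_ffact_poly /= => ->; rewrite mulr1 subrr.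
  rewrite coefB coefZ [q`_j]nth_default ?(leq_trans sq) //.
  by rewrite [_`_j]nth_default ?size_ffact_poly // mulr0 subrr.
(* The top term sums to $q_d/(d+1)$ times the next falling factorial, which $(d+1)!$ turns into the
   coefficient $d!\,q_d$. The sum of [r] comes with $d!$ and lacks the factor $d+1$. *)
exists ((d`!%:R * q`_d) *: ffact_poly d.+1 + d.+1%:R *: s) => [|n].
  rewrite (leq_trans (size_polyD _ _)) // geq_max.
  rewrite (leq_trans (size_scale_leq _ _)) ?size_ffact_poly //.
  by rewrite (leq_trans (size_scale_leq _ _)) // (leq_trans ss).
rewrite hornerD !hornerZ sE factS.
elim: n => [|n IHn].
  rewrite !big_ord0 !mulr0 addr0 /ffact_poly big_ord_recl hornerM.
  by rewrite hornerXsubC /= subr0 !(mul0r, mulr0).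
rewrite !big_ord_recr /= !mulrDr -{}IHn -[n.+1]addn1 natrD ffact_poly_rec.
rewrite /r hornerD hornerN hornerZ !natrM; ring.
Qed.

End FallingFactorial.

(** * The identity law for the explicit addition formulas *)

(** The line through the origin and [Q] is $z = lx$; its third point [S] turns out to be $-Q$, so
    negating it returns [Q]. *)
Lemma point_add0l (A : comNzRingType) (E : weierstrass A) (K : nat) (x : A)
    (Q : A * A) : x ^+ K = 0 -> small_point E x Q ->
  point_add E K (0, 0) Q = Q.
Proof.
move=> hx sQ; have sO : small_point E x (0, 0).
  by split=> /=; [rewrite /weq; ring | exists 0; rewrite mulr0 ..].
have [hD hc sS] := third_point_small hx sO sQ.
have [hv _] := point_opp_small hx sS.
have [hS _ _] := sO; have [hQ _ _] := sQ.
have [_ h2 hS2 _] := third_pointP hS hQ hD hc.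
cbv zeta in h2, hS2.
have hl := ninvP hD; have hL := ninvP hc.
set S := third_point E K (0, 0) Q in sS hv hS2 *.
set l := slope E K (0, 0) Q in hc hL h2 hS2.
have hlE : slope_den E (0, 0) Q * l = slope_num E (0, 0) Q.
  by rewrite /l /slope mulrCA hl mulr1.
have hSE : lead3 E l * (Q.1 + S.1) = wa1 E * l + wa3 E * l ^+ 2.
  rewrite /S /third_point -/l /= /lead2.
  transitivity ((lead3 E l * ninv K (lead3 E l)) * (wa1 E * l + wa3 E * l ^+ 2)).
    ring.
  by rewrite hL mul1r.
rewrite /point_add -/S /point_opp.
move: (ninv K _) hv => e hv; move: (ninv K (lead3 E l)) hL => c hL.
clearbody S l; clear hD hc sS sO hS hl sQ hQ.
move: h2 hS2; rewrite /= mulr0 subr0 !addr0 => h2 hS2.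
case: Q S => [x2 z2] [x3 z3] /= in h2 hS2 hlE hSE hv *.
rewrite {}h2 {}hS2 in hv hlE *.
pose u := 1 + wa1 E * x2 + wa3 E * (l * x2).
have h3 : x3 * u = - x2.
  (* The slope relation [hlE] amounts to $l u = x_2^2 c_3$ with $c_3$ = [lead3 E l]; combined with
     the root sum [hSE] it gives the claim. *)
  have h : lead3 E l * (x3 * u + x2) = 0.
    have -> : lead3 E l * (x3 * u + x2) =
        u * (lead3 E l * (x2 + x3) - (wa1 E * l + wa3 E * l ^+ 2))
        + (wa1 E + wa3 E * l) * (slope_den E (0, 0) (x2, l * x2) * l
                               - slope_num E (0, 0) (x2, l * x2)).
      by rewrite /u /lead3 /=; ring.
    by rewrite hSE /= hlE !subrr !mulr0 addr0.
  apply/eqP; rewrite -addr_eq0 -[X in X == _]mul1r -hL [_ * c]mulrC -mulrA h.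
  by rewrite mulr0.
have eu : e = u.
  (* The denominators for [Q] and for its negative are mutually inverse, so [e] must be [u]. *)
  have vu : (1 + wa1 E * x3 + wa3 E * (l * x3)) * u = 1.
    transitivity (u + (wa1 E + wa3 E * l) * (x3 * u)); first by ring.
    by rewrite h3 /u; ring.
  by rewrite -[LHS]mul1r -vu mulrAC hv mul1r.
by rewrite eu !mulNr -mulrA h3 mulrN !opprK.
Qed.

(** * The ring of integral sequences and congruence modulo X *)

Section IntegralSequences.
Variables (R : comNzRingType) (K : nat).
Local Notation T := {poly %/ ('X^K : {poly R})}.
Implicit Types (m i n : nat) (g h : nat -> T).

Lemma coef_qpolyM (a b : T) i : (i < K)%N ->
  (a * b)`_i = \sum_(j < i.+1) a`_j * b`_(i - j).
Proof.
move=> iK; have K0 : (0 < K)%N by apply: leq_ltn_trans iK.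
(* The modulus [mk_monic 'X^K] equals ['X^K] only for positive [K]; reduction is then truncation. *)
have modE (p : {poly R}) : Pdiv.CommonRing.rmodp p (mk_monic 'X^K) = take_poly K p.
  by rewrite mk_monic_Xn prednK // Pdiv.RingMonic.take_poly_rmodp.
by rewrite poly_of_qpolyM modE coef_take_poly iK coefM.
Qed.

Lemma coef_in_qpolyX (a : T) i : (i < K)%N -> (1 < K)%N ->
  (in_qpoly 'X^K 'X * a)`_i = if i is j.+1 then a`_j else 0.
Proof.
move=> iK K1; rewrite coef_qpolyM // in_qpoly_small ?mk_monic_Xn.
  case: i iK => [|i] iK; first by rewrite big_ord1 coefX mul0r.
  rewrite 2!big_ord_recl big1 ?coefX ?mul0r ?add0r ?addr0 ?mul1r ?subn1 //.
  by move=> j _; rewrite coefX mul0r.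
by rewrite size_polyX size_polyXn; case: K K1.
Qed.

(** Scaling the values by [superfact i] keeps the interpolating polynomial over [R], without
    fractions. *)
Definition integral_upto m g := forall i, (i < m)%N -> (i < K)%N ->
  exists2 q : {poly R}, (size q <= i.+1)%N &
    forall n, q.[n%:R] = (superfact i)%:R * (g n)`_i.

Lemma integral_upto_cst m (c : T) : integral_upto m (fun=> c).
Proof.
move=> i _ _; exists ((superfact i)%:R * c`_i)%:P => [|n]; last by rewrite hornerC.
by rewrite (leq_trans (size_polyC_leq1 _)).
Qed.

Lemma eq_integral_upto m g h : g =1 h -> integral_upto m g -> integral_upto m h.
Proof.
move=> gh gg i im iK; have [q sq qE] := gg i im iK.
by exists q => // n; rewrite -gh.
Qed.

Lemma integral_uptoD m g h : integral_upto m g -> integral_upto m h ->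
  integral_upto m (fun n => g n + h n).
Proof.
move=> gg gh i im iK; have [[p sp pE] [q sq qE]] := (gg i im iK, gh i im iK).
exists (p + q) => [|n]; last by rewrite hornerD pE qE -mulrDr -coefD.
by rewrite (leq_trans (size_polyD _ _)) // geq_max sp.
Qed.

Lemma integral_uptoM m g h : integral_upto m g -> integral_upto m h ->
  integral_upto m (fun n => g n * h n).
Proof.
move=> gg gh i im iK.
have term (j : 'I_i.+1) : exists2 q : {poly R}, (size q <= i.+1)%N &
    forall n, q.[n%:R] = (superfact i)%:R * ((g n)`_j * (h n)`_(i - j)).
  have ji : (j <= i)%N by rewrite -ltnS.
  have [p sp pE] := gg j (leq_ltn_trans ji im) (leq_ltn_trans ji iK).
  have ij := leq_subr j i.
  have [q sq qE] := gh _ (leq_ltn_trans ij im) (leq_ltn_trans ij iK).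
  have := dvdn_superfactD j (i - j); rewrite subnKC // => /dvdnP[c cE].
  exists (c%:R *: (p * q)) => [|n].
    rewrite (leq_trans (size_scale_leq _ _)) // (leq_trans (size_polyMleq _ _)) //.
    by rewrite -(subnKC ji) -subn1 leq_subLR (leq_trans (leq_add sp sq)) // addnS addSn.
  rewrite hornerZ hornerM pE qE cE !natrM; ring.
have [p sp pE] := fin_all_exists2 term.
exists (\sum_j p j) => [|n].
  by rewrite (leq_trans (size_sum _ _ _)) //; apply/bigmax_leqP.
by rewrite horner_sum coef_qpolyM // mulr_sumr; apply: eq_bigr.
Qed.

(* The quotient by X must itself be integral, which is stronger than
   coefficientwise divisibility of g n - h n by X. *)
Definition cong m g h := [/\ integral_upto m g, integral_upto m h &
  exists2 k, integral_upto m k & forall n, g n = h n + in_qpoly 'X^K 'X * k n].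

Lemma cong_refl m g : integral_upto m g -> cong m g g.
Proof.
move=> gg; split=> //; exists (fun=> 0) => [|n]; first exact: integral_upto_cst.
by rewrite mulr0 addr0.
Qed.

Lemma cong_cst m (c : T) : cong m (fun=> c) (fun=> c).
Proof. exact/cong_refl/integral_upto_cst. Qed.

Lemma congD m g g' h h' : cong m g g' -> cong m h h' ->
  cong m (fun n => g n + h n) (fun n => g' n + h' n).
Proof.
move=> [gg gg' [k gk kE]] [gh gh' [l gl lE]]; split; try exact: integral_uptoD.
exists (fun n => k n + l n) => [|n]; first exact: integral_uptoD.
by rewrite kE lE; ring.
Qed.

Lemma congM m g g' h h' : cong m g g' -> cong m h h' ->
  cong m (fun n => g n * h n) (fun n => g' n * h' n).
Proof.
move=> [gg gg' [k gk kE]] [gh gh' [l gl lE]]; split; try exact: integral_uptoM.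
(* From $gh - g'h' = (g-g')h + g'(h-h')$. *)
exists (fun n => k n * h n + g' n * l n) => [|n].
  by apply: integral_uptoD; apply: integral_uptoM.
by rewrite kE lE; ring.
Qed.

Lemma eq_cong m g g' h h' : g =1 g' -> h =1 h' -> cong m g h -> cong m g' h'.
Proof.
move=> eg eh [gg gh [k gk kE]]; split.
- exact: eq_integral_upto eg gg.
- exact: eq_integral_upto eh gh.
by exists k => // n; rewrite -eg -eh.
Qed.

Lemma congN m g h : cong m g h -> cong m (fun n => - g n) (fun n => - h n).
Proof.
by move=> gh; apply: eq_cong (congM (cong_cst m (-1)) gh) => n; rewrite mulN1r.
Qed.

Lemma congX m g h d : cong m g h -> cong m (fun n => g n ^+ d) (fun n => h n ^+ d).
Proof.
move=> gh; elim: d => [|[|d] IHd] //; first exact: cong_cst.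
exact: (congM gh IHd).
Qed.

Lemma cong_muln m g h d : cong m g h -> cong m (fun n => g n *+ d) (fun n => h n *+ d).
Proof.
move=> gh; elim: d => [|[|d] IHd] //; first exact: cong_cst.
exact: (congD gh IHd).
Qed.

Lemma cong_sum m d (g h : nat -> nat -> T) :
  (forall j, cong m (g j) (h j)) ->
  cong m (fun n => \sum_(j < d) g j n) (fun n => \sum_(j < d) h j n).
Proof.
move=> gh; elim: d => [|d IHd].
  by apply: eq_cong (cong_cst m 0) => n; rewrite big_ord0.
by apply: eq_cong (congD IHd (gh d)) => n; rewrite big_ord_recr.
Qed.

(** [ninv d] is a polynomial in its argument, so no invertibility is involved. *)
Lemma cong_ninv m d g h : cong m g h ->
  cong m (fun n => ninv d (g n)) (fun n => ninv d (h n)).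
Proof.
move=> gh; apply: (@cong_sum m d (fun j n => (1 - g n) ^+ j)
  (fun j n => (1 - h n) ^+ j)) => j.
apply: congX.
by apply: congD (cong_cst m 1) _; apply: congN.
Qed.

(** * Congruences for the group law *)

Ltac cong_tac := repeat first
  [ eassumption | apply: cong_cst | apply: cong_ninv | apply: congX
  | apply: cong_muln | apply: congN | apply: congD | apply: congM ].

Lemma cong_slope m (E : weierstrass T) x x' z z' u u' v v' :
  cong m x x' -> cong m z z' -> cong m u u' -> cong m v v' ->
  cong m (fun n => slope E K (x n, z n) (u n, v n))
         (fun n => slope E K (x' n, z' n) (u' n, v' n)).
Proof. by move=> *; rewrite /slope /=; cong_tac. Qed.

Lemma cong_third_point m (E : weierstrass T) x x' z z' u u' v v' :
  cong m x x' -> cong m z z' -> cong m u u' -> cong m v v' ->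
  cong m (fun n => (third_point E K (x n, z n) (u n, v n)).1)
         (fun n => (third_point E K (x' n, z' n) (u' n, v' n)).1) /\
  cong m (fun n => (third_point E K (x n, z n) (u n, v n)).2)
         (fun n => (third_point E K (x' n, z' n) (u' n, v' n)).2).
Proof.
move=> hx hz hu hv; have hl := cong_slope E hx hz hu hv.
have h1 : cong m (fun n => (third_point E K (x n, z n) (u n, v n)).1)
    (fun n => (third_point E K (x' n, z' n) (u' n, v' n)).1).
  by rewrite /third_point /lead2 /lead3 /=; cong_tac.
split=> //; apply: congD; first exact: congM.
by apply: congD => //; apply: congN; apply: congM.
Qed.

Lemma cong_point_add m (E : weierstrass T) x x' z z' u u' v v' :
  cong m x x' -> cong m z z' -> cong m u u' -> cong m v v' ->
  cong m (fun n => (point_add E K (x n, z n) (u n, v n)).1)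
         (fun n => (point_add E K (x' n, z' n) (u' n, v' n)).1) /\
  cong m (fun n => (point_add E K (x n, z n) (u n, v n)).2)
         (fun n => (point_add E K (x' n, z' n) (u' n, v' n)).2).
Proof.
move=> hx hz hu hv; have [h1 h2] := cong_third_point E hx hz hu hv.
by rewrite /point_add /point_opp; split; cong_tac.
Qed.

(** Multiplication by X shifts indices: coefficient $i+1$ of $g(n)$ is the sum of coefficient $i$ of
    $k(j)$ over $j<n$. This gains one index, and the summation costs $(i+1)!$, the ratio of
    consecutive superfactorials. *)
Lemma integral_of_cong_succ m g : (1 < K)%N -> g 0%N = 0 ->
  cong m (fun n => g n.+1) g -> integral_upto m.+1 g.
Proof.
move=> K1 g0 [_ _ [k gk kE]] i im iK.
have gS n : (g n.+1)`_i = (g n)`_i + (if i is j.+1 then (k n)`_j else 0).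
  by rewrite kE coefD coef_in_qpolyX.
case: i im iK gS => [|i] im iK gS.
  (* The constant coefficient does not change with [n] and starts at 0. *)
  exists 0 => [|n]; rewrite ?size_poly0 // horner0.
  suff -> : (g n)`_0 = 0 by rewrite mulr0.
  by elim: n => [|n IHn]; rewrite ?g0 ?coef0 // gS IHn addr0.
have [q sq qE] := gk i im (ltnW iK).
have [s ss sE] := fact_sum_poly sq.
exists s => // n; rewrite {}sE superfactS.
suff -> : \sum_(j < n) q.[j%:R] = (superfact i)%:R * (g n)`_i.+1.
  by rewrite mulrA [(_ * _)%N]mulnC natrM.
elim: n => [|n IHn]; first by rewrite big_ord0 g0 coef0 mulr0.
by rewrite big_ord_recr /= IHn qE gS mulrDr.
Qed.

End IntegralSequences.

(** Both coordinates go through one induction on [m], since each coordinate of a sum depends on both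
    coordinates of the summands. *)
Lemma integral_point_mul K (E : weierstrass (trunc_ring K)) F m :
  (1 < K)%N -> paramF E (trX K) F ->
  integral_upto m (fun n => (point_mul E K n (trX K, F)).1) /\
  integral_upto m (fun n => (point_mul E K n (trX K, F)).2).
Proof.
move=> K1 hF; set x := trX K; set P := point_mul E K.
have xK : x ^+ K = 0 by apply/trX_nilp/ltnW.
elim: m => [|m [IH1 IH2]]; first by split=> i.
have cx : cong m (fun=> x) (fun=> 0).
  split; [exact: integral_upto_cst.. | exists (fun=> 1) => [|n]].
    exact: integral_upto_cst.
  by rewrite add0r mulr1.
have [[f Ff] _] := hF.
have cF : cong m (fun=> F) (fun=> 0).
  split; [exact: integral_upto_cst.. | exists (fun=> x ^+ 2 * f) => [|n]].
    exact: integral_upto_cst.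
  by rewrite add0r Ff mulrA -exprS.
(* This compares $P + nP$ with $O + nP$, that is, with $nP$ by [P0]. *)
have [c1 c2] := cong_point_add E cx cF (cong_refl IH1) (cong_refl IH2).
have PS n : P n.+1 (x, F) = point_add E K (x, F) ((P n (x, F)).1, (P n (x, F)).2).
  by rewrite -surjective_pairing.
have P0 n : point_add E K (0, 0) ((P n (x, F)).1, (P n (x, F)).2) = P n (x, F).
  rewrite -surjective_pairing; exact: point_add0l xK (point_mul_small n xK hF).
split.
  apply: (@integral_of_cong_succ _ _ _ (fun n => (P n (x, F)).1) K1 erefl).
  by apply: eq_cong c1 => n; [rewrite PS | rewrite P0].
apply: (@integral_of_cong_succ _ _ _ (fun n => (P n (x, F)).2) K1 erefl).
by apply: eq_cong c2 => n; [rewrite PS | rewrite P0].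
Qed.

(** * Passage to rational coefficients *)

Lemma poly_natr_inj (R : idomainType) (p q : {poly R}) :
  injective (fun n => n%:R : R) ->
  (forall n, p.[n%:R] = q.[n%:R]) -> p = q.
Proof.
move=> R0 pq; apply/eqP; rewrite -subr_eq0; apply: contraT => d0.
have := max_poly_roots d0 (rs := [seq n%:R | n <- iota 0 (size (p - q))]).
rewrite size_map size_iota ltnn; apply; last by rewrite map_inj_uniq ?iota_uniq.
by apply/allP => _ /mapP[n _ ->]; rewrite rootE hornerD hornerN pq subrr.
Qed.

Theorem mainTheorem2 (K : nat) (F : trunc_ring K)
    (hF : paramF (generic_curve K) (trX K) F) (i : nat)
    (hi : (1 <= i)%N) (hiK : (i < K)%N) :
  exists p : {poly Qa},
    unique (fun p' : {poly Qa} =>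
      forall n : nat, p'.[n%:R] = ZtoQ (mult_poly F i n)) p
    /\ exists q : {poly Za}, (superfact i)%:R *: p = map_poly ZtoQ q.
Proof.
have [gx _] := integral_point_mul i.+1 (leq_ltn_trans hi hiK) hF.
have [q _ qE] := gx i (ltnSn i) hiK.
have Pi0 : (superfact i)%:R != 0 :> rat.
  by rewrite Num.Theory.pnatr_eq0 -lt0n superfact_gt0.
(* The inverse of $\Pi(i)$ exists in [rat] and enters [Qa] as a constant. *)
pose c : Qa := ((superfact i)%:R^-1 : rat)%:MP.
have cE : (superfact i)%:R * c = 1 :> Qa.
  by rewrite /c -mpolyC_nat -mpolyCM divff.
exists (c *: map_poly ZtoQ q); split; last by exists q; rewrite scalerA cE scale1r.
have pE n : (c *: map_poly ZtoQ q).[n%:R] = ZtoQ (mult_poly F i n).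
  rewrite hornerZ -[n%:R](rmorph_nat (map_mpoly (intr : int -> rat))) horner_map.
  by rewrite qE /= rmorphM rmorph_nat mulrA [c * _]mulrC cE mul1r.
split=> // p' hp'; apply: poly_natr_inj => [m n|n]; last by rewrite pE hp'.
(* Constant coefficients reduce the injectivity of the naturals in [Qa] to that in [rat]. *)
rewrite -!mpolyC_nat => /(congr1 (mcoeff 0%MM)); rewrite !mcoeffC eqxx !mulr1.
by move/eqP; rewrite Num.Theory.eqr_nat => /eqP.
Qed.
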